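(* For every integer $n\ge 6$, the pendant path graph $P_n^*$ does not have the $(n-1)$-EKR property.
   Context: All graphs are finite and simple. For a graph $G$ and $r\in\mathbb{N}$, $\mathcal{I}^{(r)}(G)$ denotes the family of independent $r$-subsets of $V(G)$. A subfamily $\mathcal{A}\subseteq\mathcal{I}^{(r)}(G)$ is intersecting if every two members have nonempty intersection. For $v\in V(G)$, the $r$-star centered at $v$ is $\{A\in\mathcal{I}^{(r)}(G): v\in A\}$. A graph $G$ has the $r$-EKR property (is $r$-EKR) if every largest intersecting subfamily of $\mathcal{I}^{(r)}(G)$ is an $r$-star, i.e., all its members contain a common vertex. The pendant path graph $P_n^*$ has vertices $x_1,\dots,x_n,p_1,\dots,p_n$ and edges $x_ix_{i+1}$ for $1\le i\le n-1$ together with $x_ip_i$ for $1\le i\le n$. *)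

(* Defs.v *)
From mathcomp Require Import all_boot.

Set Implicit Arguments.
Unset Strict Implicit.
Unset Printing Implicit Defensive.

Record sgraph := SGraph {
  vertex :> finType;
  adj : rel vertex;
  adj_sym : symmetric adj;
  adj_irr : irreflexive adj
}.

Section EKR.
Variable G : sgraph.

Definition independent (A : {set G}) : bool :=
  [forall u in A, forall v in A, ~~ adj u v].

Definition indep_sets (r : nat) : {set {set G}} :=
  [set A : {set G} | independent A & #|A| == r].

Definition intersecting (F : {set {set G}}) : bool :=
  [forall A in F, forall B in F, A :&: B != set0].

Definition star (r : nat) (v : G) : {set {set G}} :=
  [set A in indep_sets r | v \in A].

Definition intersecting_subfamily (r : nat) (F : {set {set G}}) : Prop :=
  F \subset indep_sets r /\ intersecting F.

Definition largest_intersecting (r : nat) (F : {set {set G}}) : Prop :=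
  intersecting_subfamily r F /\
  (forall F' : {set {set G}}, intersecting_subfamily r F' -> #|F'| <= #|F|).

(* For a largest family, being equal to a star is the same as having a vertex
   common to all members: the star at that vertex is itself intersecting. *)
Definition has_EKR (r : nat) : Prop :=
  forall F : {set {set G}}, largest_intersecting r F ->
  exists v : G, F = star r v.

End EKR.

Section PendantPath.
Variable n : nat.

(* [inl i] is the path vertex x_(i+1) and [inr i] its pendant p_(i+1). *)
Definition pendant_path_adj (u v : 'I_n + 'I_n) : bool :=
  match u, v with
  | inl i, inl j => (i.+1 == j :> nat) || (j.+1 == i :> nat)
  | inl i, inr j => i == j
  | inr i, inl j => i == j
  | inr _, inr _ => false
  end.

Lemma pendant_path_adj_sym : symmetric pendant_path_adj.
Proof. by move=> [i|i] [j|j] //=; rewrite 1?orbC // eq_sym. Qed.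

Lemma pendant_path_adj_irr : irreflexive pendant_path_adj.
Proof. by case=> i //=; rewrite orbb; apply/negbTE; rewrite gtn_eqF. Qed.

Definition pendant_path : sgraph :=
  SGraph pendant_path_adj_sym pendant_path_adj_irr.

End PendantPath.

(* Main.v *)
Require Import Defs.
From mathcomp Require Import all_boot.
From mathcomp Require Import zify.

(** Write [W a] for the set of all pendants except [p_a].  An independent
    [(n-1)]-set [B] uses each column [{x_i, p_i}] at most once, hence misses
    exactly one column.  If [B] avoided [W a], then among any two consecutive
    columns other than [a] one would be missing; for [n >= 6] the three disjoint
    pairs of columns {1,2}, {3,4}, {5,6} leave two pairs without [a], hence two
    missing columns, which is absurd.  So [W a] meets every independent
    [(n-1)]-set, and therefore belongs to every largest intersecting family.  The
    sets [W a] have no common vertex, so such a family is not a star. *)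

Set Implicit Arguments.
Unset Strict Implicit.
Unset Printing Implicit Defensive.

Section LargestFamilies.
Variables (G : sgraph) (r : nat).

Lemma largest_intersecting_exists :
  exists F : {set {set G}}, largest_intersecting r F.
Proof.
pose P (F : {set {set G}}) := (F \subset indep_sets G r) && intersecting F.
have P0 : P set0.
  by rewrite /P sub0set; apply/forall_inP => A; rewrite inE.
case: (arg_maxnP (fun F : {set {set G}} => #|F|) P0) => F /andP[sF iF] maxF.
by exists F; split=> [//|F' [sF' iF']]; apply: maxF; apply/andP.
Qed.

(** If [W] were missing, [W |: F] would be a strictly larger intersecting family. Taking [B = W] in
    the last hypothesis covers the pair [W], [W]. *)
Lemma mem_largest_intersecting (F : {set {set G}}) (W : {set G}) :
  largest_intersecting r F -> W \in indep_sets G r ->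
  (forall B, B \in indep_sets G r -> W :&: B != set0) ->
  W \in F.
Proof.
move=> [[sF iF] maxF] indW meetW; apply: contraT => WF.
suff: #|W |: F| <= #|F| by rewrite cardsU1 WF ltnn.
apply: maxF; split; first by rewrite subUset sub1set indW.
apply/forall_inP => A /setU1P[->|AF]; apply/forall_inP => B /setU1P[->|BF].
- exact: meetW.
- exact/meetW/(subsetP sF).
- by rewrite setIC; apply/meetW/(subsetP sF).
- by move/forall_inP: iF => /(_ A AF)/forall_inP; apply.
Qed.

End LargestFamilies.

Section PendantPathSets.
Variable n : nat.
Local Notation G := (pendant_path n).

Definition column (u : G) : 'I_n := match u with inl i => i | inr i => i end.

Definition pendants_but (a : 'I_n) : {set G} :=
  [set (inr i : 'I_n + 'I_n) | i in [set~ a]].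

Lemma mem_pendants_but (a i : 'I_n) :
  ((inr i : G) \in pendants_but a) = (i != a).
Proof. by rewrite mem_imset ?inE // => ? ? []. Qed.

Lemma pendants_but_indep (a : 'I_n) :
  pendants_but a \in indep_sets G (n - 1).
Proof.
rewrite inE; apply/andP; split.
  by apply/forall_inP => _ /imsetP[i _ ->]; apply/forall_inP => _ /imsetP[j _ ->].
rewrite card_imset => [|? ? []//].
by rewrite cardsC1 card_ord subn1.
Qed.

Lemma independent_adj (B : {set G}) (u v : G) :
  independent B -> u \in B -> v \in B -> ~~ adj u v.
Proof. by move=> /forall_inP indB uB vB; move/forall_inP: (indB u uB); apply. Qed.

(** Two distinct vertices of one column are a path vertex and its own pendant, which are
    adjacent. *)
Lemma column_inj (B : {set G}) : independent B -> {in B &, injective column}.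
Proof.
move=> indB [i|i] [j|j] uB vB /= eij; rewrite eij // in uB *.
- by have := independent_adj indB uB vB; rewrite /= eqxx.
- by have := independent_adj indB uB vB; rewrite /= eqxx.
Qed.

Lemma missing_column (B : {set G}) :
  0 < n -> B \in indep_sets G (n - 1) -> exists c, ~: (column @: B) = [set c].
Proof.
move=> n_gt0; rewrite inE => /andP[indB /eqP cardB].
apply/cards1P; rewrite -(eqn_add2l #|column @: B|) cardsC card_ord.
rewrite card_in_imset; last exact: column_inj.
by rewrite cardB subnK.
Qed.

Lemma pendants_but_meet (a : 'I_n) (B : {set G}) :
  6 <= n -> B \in indep_sets G (n - 1) -> pendants_but a :&: B != set0.
Proof.
move=> n_ge6 indB; apply/negP; rewrite setI_eq0 => /pred0P disjWB.
have [c defc] := missing_column (leq_trans (isT : 0 < 6) n_ge6) indB.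
(* Column [i] is occupied, and not by its pendant, which lies in [pendants_but a]. *)
have path_mem (i : 'I_n) : i != a -> i != c -> (inl i : G) \in B.
  move=> ia ic; have : i \in column @: B.
    by move/setP: defc => /(_ i); rewrite !inE (negbTE ic) => /negbFE.
  case/imsetP => -[j|j] jB ij; rewrite /= in ij; subst j => //.
  by have := disjWB (inr i); rewrite /= jB andbT mem_pendants_but ia.
(* Counting from 0, pair [k] consists of columns [k.*2] and [k.*2.+1], those whose half is [k]. If
   it contained neither [a] nor [c], two adjacent path vertices would lie in [B]. *)
have pair_hit (k : nat) : k < 3 -> (a./2 == k) || (c./2 == k).
  move=> k_lt3; apply: contraT; rewrite negb_or => /andP[ak ck].
  have lt0 : k.*2 < n by lia.
  have lt1 : k.*2.+1 < n by lia.
  move: indB; rewrite inE => /andP[indB _].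
  have mem0 : (inl (Ordinal lt0) : G) \in B.
    by apply: path_mem; rewrite -val_eqE /=; lia.
  have mem1 : (inl (Ordinal lt1) : G) \in B.
    by apply: path_mem; rewrite -val_eqE /=; lia.
  by have := independent_adj indB mem0 mem1; rewrite /= eqxx.
(* Pigeonhole: [a./2] and [c./2] cannot take all three values 0, 1, 2. *)
have := (pair_hit 0 isT, pair_hit 1 isT, pair_hit 2 isT).
by case=> [[]]; lia.
Qed.

End PendantPathSets.

Theorem theorem7 (n : nat) (n_ge6 : 6 <= n) : ~ has_EKR (pendant_path n) (n - 1).
Proof.
move=> ekr; have [F largeF] := largest_intersecting_exists (pendant_path n) (n - 1).
have [v defF] := ekr F largeF.
(* This set omits the centre [v], be it a path vertex or a pendant, so it is not in the star at
   [v]. *)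
have : pendants_but (column v) \in F.
  apply: (mem_largest_intersecting largeF) => [|B].
  - exact: pendants_but_indep.
  - exact: pendants_but_meet.
rewrite defF inE => /andP[_]; case/imsetP => i; rewrite inE => ia ev.
by rewrite ev /= in_set1 eqxx in ia.
Qed.
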